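(* Let $\nu>0$ and let $F\in V'$ with $F\ge0$. Suppose that: (i) the sequence $\{f_n\}$ in $L^\infty_\nu(\Omega)$, with $0\le f_n\le F$ for all $n\in\mathbb{N}$, is non-increasing and $\lim_{n\to\infty}f_n=f^*$ in $L^\infty(\Omega)$ for some $f^*\in L^\infty_\nu(\Omega)$; (ii) the increasing map $\Phi:H^+\to H^+$ satisfies $$\lambda\Phi(y)\ge\Phi(\lambda y)\quad\text{for all }\lambda>1,\ y\in H^+,$$ and if $\{v_n\}$ is bounded in $V$ and $v_n\downarrow v$ in $H$, then $\Phi(v_n)\to\Phi(v)$ in $H$. Then $$\mathbf{m}(f_n)\downarrow\mathbf{m}(f^* )\ \text{in } H,\quad\text{and}\quad\mathbf{m}(f_n)\to\mathbf{m}(f^* )\ \text{in } V.$$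
   Context: $(V,H,V')$ is a Gelfand triple of Hilbert spaces: $V\hookrightarrow H\hookrightarrow V'$ with dense and continuous embeddings, $H$ identified with $H'$; $\langle\cdot,\cdot\rangle$ is the duality pairing of $V'$ and $V$, $(\cdot,\cdot)$ the inner product of $H$. $H^+\subset H$ is a closed convex cone with $H^+=\{v\in H:(v,y)\ge0\ \forall y\in H^+\}$, and $x\le y$ means $y-x\in H^+$. For $x\in H$, $x^+$ is the orthogonal projection of $x$ onto $H^+$ and $x^-:=x^+-x$; $\sup(x,y):=x+(y-x)^+$, $\inf(x,y):=x-(x-y)^+$. It is assumed that $y\in V$ implies $y^+\in V$, and $\|y^+\|_V\le M\|y\|_V$ for all $y\in V$ and some $M>0$. $V$ and $H$ are spaces of functions $h:\Omega\to\mathbb{R}$ on an open set $\Omega\subset\mathbb{R}^N$, with $L^\infty(\Omega)\hookrightarrow H$ densely and continuously, and $L^\infty(\Omega)$ inherits the order of $H$ (prototype: $V=H_0^1(\Omega)$, $H=L^2(\Omega)$, $H^+$ the a.e. non-negative functions). In $V'$, $f_1\le f_2$ means $\langle f_2-f_1,v\rangle\ge0$ for all $v\in V$ with $v\ge0$. $L^\infty_\nu(\Omega):=\{z\in L^\infty(\Omega): z(x)\ge\nu \text{ for a.a. } x\in\Omega\}$. For $x\le y$ in $H$, $[x,y]:=\{z\in H:x\le z\le y\}$. $z_n\downarrow z$ in $H$ means $z_n\ge z_{n+1}$ for all $n$ and $z_n\to z$ in $H$. $A:V\to V'$ (possibly nonlinear) is: homogeneous of order one ($A(tu)=tA(u)$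 for $u\in V$, $t>0$); Lipschitz continuous ($\|A(u)-A(v)\|_{V'}\le C\|u-v\|_V$); strongly monotone ($\langle A(u)-A(v),u-v\rangle\ge c\|u-v\|_V^2$ for some $c>0$); and T-monotone ($\langle A(u)-A(v),(u-v)^+\rangle\ge0$ for all $u,v\in V$, with equality if and only if $(u-v)^+=0$). $\Phi:H^+\to H^+$ is increasing ($0\le v\le w$ implies $\Phi(v)\le\Phi(w)$), extended to $H$ by $x\mapsto\Phi(x^+)$ when needed. For $\psi\in H^+$, $\mathbf{K}(\psi):=\{v\in V:v\le\psi\}$; for $f\in V'$, $S(f,\psi)$ is the unique $y\in\mathbf{K}(\psi)$ with $\langle A(y)-f,v-y\rangle\ge0$ for all $v\in\mathbf{K}(\psi)$. Let $\overline{y}\in V$ be the unique solution of $A(\overline{y})=F$. For $f\in V'$ with $0\le f\le F$, the set of fixed points of $y\mapsto S(f,\Phi(y))$ in $[0,\overline{y}]$ is non-empty and has a smallest element, denoted $\mathbf{m}(f)$.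
   Formalization: The formal statement adds the assumption that sup(x,y)=x+(y-x)^+ is really the least upper bound of x and y for the order of H; this does not follow from self-duality of H^+, and without it m(f) may fail to exist. *)

(* Defs.v *)
(* MathComp-Analysis, over an arbitrary [R : realType]. *)
From HB Require Import structures.
From mathcomp Require Import all_boot all_order all_algebra ring lra.
From mathcomp Require Import all_classical all_reals all_analysis.

Set Implicit Arguments.
Unset Strict Implicit.
Unset Printing Implicit Defensive.

Import Order.TTheory GRing.Theory Num.Theory.
Import numFieldNormedType.Exports.

Local Open Scope classical_set_scope.
Local Open Scope ring_scope.

HB.mixin Record isHilbert (R : realType) H & CompleteNormedModule R H := {
  inner : H -> H -> R ;
  innerC : forall x y, inner x y = inner y x ;
  innerP : forall a x y z, inner (a *: x + y) z = a * inner x z + inner y z ;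
  inner_norm : forall x, inner x x = `|x| ^+ 2
}.

#[short(type="hilbertType")]
HB.structure Definition Hilbert (R : realType) :=
  {H of CompleteNormedModule R H & isHilbert R H}.

(* V', the space of continuous linear functionals on V. *)
Section dual_space.
Context (R : realType) (V : normedModType R).

Definition dual_pred : {pred V -> R} :=
  mem [set f : V -> R | linear_for *%R f /\ continuous f].

Record dual := Dual { dual_fun :> V -> R ; dual_funP : dual_fun \in dual_pred }.

HB.instance Definition _ := [isSub for dual_fun].
HB.instance Definition _ := [Choice of dual by <:].

Lemma dual_submod_closed : submod_closed dual_pred.
Proof.
split; first by rewrite inE; split; [move=> a x y; rewrite mulr0 addr0|exact: cst_continuous].
move=> a f g; rewrite !inE => -[lf cf] [lg cg]; split.
  move=> b x y; rewrite /= !fctE /=.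
  rewrite lf lg !scalerDr /GRing.scale /= !mulrDr !addrA; congr (_ + _).
  by rewrite -!addrA mulrCA; congr (_ + _); rewrite addrC.
move=> x; apply: cvgD; last exact: cg.
by apply: cvgZl_tmp; exact: cf.
Qed.

HB.instance Definition _ := GRing.isSubmodClosed.Build _ _ dual_pred
  dual_submod_closed.
HB.instance Definition _ := [SubChoice_isSubLmodule of dual by <:].

Definition dual_norm (f : dual) : R :=
  sup [set `|f v| | v in [set v : V | `|v| <= 1]].

End dual_space.

Record gelfand_embedding (R : realType) (V H : hilbertType R) := {
  emb :> {linear V -> H} ;
  emb_inj : injective emb ;
  emb_continuous : continuous emb ;
  emb_dense : dense (range emb)
}.

Section gelfand_triple.
Context (R : realType) (V H : hilbertType R) (i : gelfand_embedding V H).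

Lemma innerPr (x : H) (a : R) (y z : H) :
  inner x (a *: y + z) = a * inner x y + inner x z.
Proof. by rewrite 3!(innerC x); exact: innerP. Qed.

Lemma norm_inner_le (x y : H) : `|inner x y| <= `|x| * `|y|.
Proof.
have [->|y0] := eqVneq y 0.
  have := innerPr x 1 0 0; rewrite scale1r addr0 mul1r => /eqP.
  by rewrite -[X in X == _]addr0 (inj_eq (addrI _)) => /eqP <-; rewrite !normr0 mulr0.
have ny : 0 < `|y| ^+ 2 by rewrite exprn_gt0// normr_gt0.
rewrite -(@ler_pXn2r _ 2)// ?nnegrE ?mulr_ge0// exprMn real_normK ?num_real//.
pose t := - (inner x y / `|y| ^+ 2).
have := sqr_ge0 `|t *: y + x|.
rewrite -inner_norm innerPr !innerP inner_norm inner_norm (innerC y x) /t.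
set a := inner x y; set b := `|y| ^+ 2 in ny *; set c := `|x| ^+ 2 => h.
rewrite -subr_ge0.
have -> : c * b - a ^+ 2 = b * (- (a / b) * (- (a / b) * b + a) + (- (a / b) * a + c)).
  by field; rewrite gt_eqF.
by rewrite mulr_ge0// ltW.
Qed.

Lemma pivot_subproof (h : H) : (fun v => inner h (i v)) \in @dual_pred R V.
Proof.
rewrite inE; split.
  by move=> a u v; rewrite linearP; exact: innerPr.
have lin u v : inner h (i u) - inner h (i v) = inner h (i (u - v)).
  by rewrite linearB [in RHS]addrC -(scaleN1r (i v)) innerPr mulN1r addrC.
move=> v; apply/cvgrPdist_lt => e e0.
have /cvgrPdist_lt/(_ (e / (`|h| + 1))) := @emb_continuous _ _ _ i v.
rewrite divr_gt0// ?ltr_wpDl// => /(_ isT); apply: filterS => u.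
rewrite ltr_pdivlMr ?ltr_wpDl// -linearB => uv.
rewrite lin (le_lt_trans (norm_inner_le _ _))// (le_lt_trans _ uv)// mulrC.
by rewrite ler_wpM2l// lerDl.
Qed.

(* The embedding of H in V' obtained by identifying H with its dual. *)
Definition pivot (h : H) : dual V := Dual (pivot_subproof h).

End gelfand_triple.

Section ordered_triple.
Context (R : realType) (V H : hilbertType R) (i : gelfand_embedding V H).
Variable Hp : set H.

Definition self_dual_cone : Prop :=
  [/\ closed Hp,
      (forall x y, Hp x -> Hp y -> Hp (x + y)),
      (forall (t : R) x, 0 <= t -> Hp x -> Hp (t *: x)) &
      Hp = [set v | forall y, Hp y -> 0 <= inner v y]].

Definition leH (x y : H) : Prop := Hp (y - x).

(* In the definitions by [xget 0] below, [0] is only the value taken when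
   no object has the defining property. *)
Definition proj (C : set H) (x : H) : H :=
  xget 0 [set p | C p /\ forall z, C z -> `|x - p| <= `|x - z|].

Definition pos (x : H) : H := proj Hp x.

Definition supH (x y : H) : H := x + pos (y - x).

(* [supH x y] is the supremum of x and y for [leH]. Leastness is not a
   consequence of [self_dual_cone]: it fails for the Lorentz cone in R^3. *)
Definition sup_is_supremum : Prop := forall x y,
  [/\ leH x (supH x y), leH y (supH x y) &
      forall z, leH x z -> leH y z -> leH (supH x y) z].

(* y^+ as an element of V, for y in V. *)
Definition posV (y : V) : V := xget 0 [set w | i w = pos (i y)].

Definition pos_stable : Prop :=
  (forall y : V, range i (pos (i y))) /\
  exists2 M : R, 0 < M & forall y : V, `|posV y| <= M * `|y|.

Definition leV' (f g : dual V) : Prop := forall v, Hp (i v) -> 0 <= (g - f) v.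

Definition decreases_to (z : nat -> H) (l : H) : Prop :=
  (forall k, leH (z k.+1) (z k)) /\ z @ \oo --> l.

Section operator.
Variable A : V -> dual V.

Definition homogeneous1 : Prop :=
  forall (t : R) u, 0 < t -> A (t *: u) = t *: A u.

Definition lipschitz_dual : Prop :=
  exists C : R, forall u v, dual_norm (A u - A v) <= C * `|u - v|.

Definition strongly_monotone : Prop :=
  exists2 c : R, 0 < c & forall u v, c * `|u - v| ^+ 2 <= (A u - A v) (u - v).

Definition T_monotone : Prop := forall u v,
  0 <= (A u - A v) (posV (u - v)) /\
  ((A u - A v) (posV (u - v)) = 0 <-> posV (u - v) = 0).

Definition obstacle_set (psi : H) : set V := [set v | leH (i v) psi].

(* S(f, psi) *)
Definition VI_solution (f : dual V) (psi : H) : V :=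
  xget 0 [set y | obstacle_set psi y /\
                  forall v, obstacle_set psi v -> 0 <= (A y - f) (v - y)].

(* A map [Phi : H -> H] stands for a map defined on [Hp] only; it is always
   evaluated through this extension, which ignores its values off [Hp]. *)
Definition extend (Phi : H -> H) (x : H) : H := Phi (pos x).

Definition state (F : dual V) : V := xget 0 [set y | A y = F].

(* The fixed points of y |-> S(f, Phi y) in [0, ybar] with A(ybar) = F; they
   belong to V since S takes its values there. *)
Definition QVI_solutions (F : dual V) (Phi : H -> H) (f : dual V) : set V :=
  [set y | [/\ leH 0 (i y), leH (i y) (i (state F)) &
               y = VI_solution f (extend Phi (i y))]].

Definition min_solution (F : dual V) (Phi : H -> H) (f : dual V) : V :=
  xget 0 [set y | QVI_solutions F Phi f y /\
                  forall z, QVI_solutions F Phi f z -> leH (i y) (i z)].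

End operator.

End ordered_triple.

Section lebesgue_Rn.
Context (R : realType) (n : nat).
Local Open Scope ereal_scope.

Let E : Type := 'rV[R]_n.+1.

Definition box (ab : E * E) : set E :=
  [set x | forall j, (ab.1 ord0 j < x ord0 j <= ab.2 ord0 j)%R].

Definition box_vol (ab : E * E) : R := (\prod_j (ab.2 ord0 j - ab.1 ord0 j))%R.

Definition box_cover (X : set E) : set (nat -> E * E) :=
  [set c : nat -> E * E | (forall k j, ((c k).1 ord0 j <= (c k).2 ord0 j)%R) /\
           X `<=` \bigcup_k box (c k)].

Definition lebesgue_outer (X : set E) : \bar R :=
  ereal_inf [set \sum_(k <oo) (box_vol (c k))%:E | c in box_cover X].

Lemma box_vol_ge0 (X : set E) c : box_cover X c -> forall k, 0 <= (box_vol (c k))%:E.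
Proof. by move=> [cle _] k; rewrite lee_fin prodr_ge0// => j _; rewrite subr_ge0. Qed.

Lemma lebesgue_outer_ge0 X : 0 <= lebesgue_outer X.
Proof.
apply: le_ereal_inf_tmp => _ [c Xc <-].
by apply: nneseries_ge0 => k _ _; exact: (box_vol_ge0 Xc).
Qed.

Lemma lebesgue_outer0 : lebesgue_outer set0 = 0.
Proof.
apply/eqP; rewrite eq_le lebesgue_outer_ge0 andbT.
apply: ereal_inf_lbound; exists (fun=> (0%R, 0%R)); first by split.
by rewrite eseries0// => k _ _; rewrite /box_vol big_ord_recl /= subrr mul0r.
Qed.

Lemma le_lebesgue_outer : {homo lebesgue_outer : X Y / X `<=` Y >-> X <= Y}.
Proof.
move=> X Y XY; apply/ereal_inf_le_tmp => _ [c [cle Yc] <-].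
by exists c => //; split => //; exact: subset_trans Yc.
Qed.

Lemma lebesgue_outer_sigma_subadditive : sigma_subadditive lebesgue_outer.
Proof.
move=> A; have [[i ioo]|] := pselect (exists i, lebesgue_outer (A i) = +oo).
  rewrite (eseries_pinfty _ _ ioo) ?leey// => k _.
  by rewrite -ltNye (lt_le_trans _ (lebesgue_outer_ge0 _)).
rewrite -forallNE => Aoo.
suff add2e (e : {posnum R}) : lebesgue_outer (\bigcup_k A k) <=
    \sum_(i <oo) lebesgue_outer (A i) + e%:num%:E.
  by apply/lee_addgt0Pr => _/posnumP[].
rewrite (le_trans _ (epsilon_trick _ _ _))//; last first.
  by move=> k; exact: lebesgue_outer_ge0.
pose P k (c : nat -> E * E) := box_cover (A k) c /\
  \sum_(l <oo) (box_vol (c l))%:E <=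
  lebesgue_outer (A k) + (e%:num / (2 ^ k.+1)%:R)%:E.
have [G PG] : {G : nat -> nat -> E * E & forall k, P k (G k)}.
  apply: (@choice _ _ P) => k; rewrite /P.
  have Afin : lebesgue_outer (A k) \is a fin_num.
    rewrite ge0_fin_numE ?lebesgue_outer_ge0//.
    by rewrite ltey; apply/eqP; exact: Aoo.
  have ek : (0 < e%:num / (2 ^ k.+1)%:R)%R by [].
  have [_ [c Ac <-] clt] := lb_ereal_inf_adherent ek Afin.
  by exists c; split => //; exact/ltW.
pose vol (kl : nat * nat) := (box_vol (G kl.1 kl.2))%:E.
have vol_ge0 kl : 0 <= vol kl by exact: (box_vol_ge0 (PG kl.1).1).
apply: (@le_trans _ _ (\esum_(kl in setT) vol kl)).
  apply: ereal_inf_lbound => /=.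
  have /card_esym/ppcard_eqP[g] := card_nat2.
  exists (fun k => G (g k).1 (g k).2).
    split => [k|]; first exact: (PG (g k).1).1.1.
    move=> t [k _ Akt]; have [l _ Gklt] := (PG k).1.2 _ Akt.
    by exists (g^-1%FUN (k, l)) => //=; rewrite invK ?inE.
  transitivity (\sum_(k <oo) vol (g k)) => //.
  rewrite -(esum_pred_image vol g xpredT) ?[fun=> _]set_true//.
  by rewrite image_eq.
rewrite (_ : esum _ _ = \sum_(k <oo) \sum_(l <oo) vol (k, l)); last first.
  pose J : nat -> set (nat * nat) := fun k => [set (k, l) | l in setT].
  rewrite (_ : setT = \bigcup_k J k); last first.
    by rewrite predeqE => -[a b]; split => // _; exists a => //; exists b.
  rewrite esum_bigcupT /=; last 2 first.
    - apply/trivIsetP => k l _ _ kl.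
      rewrite predeqE => -[p q] /=; split => //= -[] [_] _ [<-{p} _].
      by move=> [q' _] [] /esym/eqP; rewrite (negbTE kl).
    - by move=> kl; exact: vol_ge0.
  rewrite -(image_id [set: nat]) -fun_true esum_pred_image//; last first.
    by move=> k _; exact: esum_ge0.
  apply: eq_eseriesr => /= k _.
  rewrite -(esum_pred_image vol (pair k) predT)//=; last first.
    by move=> ? ? _ _; exact: (@can_inj _ _ _ snd).
  by congr esum; rewrite predeqE => -[a b]; split; move=> [l _ <-]; exists l.
apply: lee_lim.
- apply: is_cvg_nneseries => k *.
  by apply: nneseries_ge0 => m *; exact: (vol_ge0 (k, m)).
- by apply: is_cvg_nneseries => k *; apply: adde_ge0 => //; exact: lebesgue_outer_ge0.
- by near=> k; apply: lee_sum => l _; exact: (PG l).2.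
Unshelve. all: by end_near. Qed.

(* The Lebesgue outer measure restricted to Omega. For Omega open (hence Lebesgue
   measurable), X is Caratheodory measurable for it iff X `&` Omega is Lebesgue
   measurable: up to a.e. equality, the functions that are measurable for
   [domain Omega] are the Lebesgue measurable functions on Omega, extended
   arbitrarily outside Omega, which is negligible. *)
Definition lebesgue_on (Omega X : set E) : \bar R := lebesgue_outer (X `&` Omega).

Section restriction.
Variable Omega : set E.

Let lebesgue_on0 : lebesgue_on Omega set0 = 0.
Proof. by rewrite /lebesgue_on set0I lebesgue_outer0. Qed.

Let lebesgue_on_ge0 X : 0 <= lebesgue_on Omega X.
Proof. exact: lebesgue_outer_ge0. Qed.

Let le_lebesgue_on : {homo lebesgue_on Omega : X Y / X `<=` Y >-> X <= Y}.
Proof. by move=> X Y XY; apply: le_lebesgue_outer; exact: setSI. Qed.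

Let lebesgue_on_sigma_subadditive : sigma_subadditive (lebesgue_on Omega).
Proof.
by move=> A; rewrite /lebesgue_on setI_bigcupl; exact: lebesgue_outer_sigma_subadditive.
Qed.

HB.instance Definition _ := isOuterMeasure.Build R E (lebesgue_on Omega)
  lebesgue_on0 lebesgue_on_ge0 le_lebesgue_on lebesgue_on_sigma_subadditive.

End restriction.

Definition lebesgue_omeasure (Omega : set E) : {outer_measure set E -> \bar R} :=
  lebesgue_on Omega.

Definition domain (Omega : set E) := caratheodory_type (lebesgue_omeasure Omega).

Definition lebesgue (Omega : set E) : {measure set domain Omega -> \bar R} :=
  lebesgue_omeasure Omega : set (caratheodory_type (lebesgue_omeasure Omega)) -> \bar R.

(* Elements are functions; equality in L^oo(Omega) is equality a.e. *)
Definition Linfty (Omega : set E) := LfunType (lebesgue Omega) (leey (1 : \bar R)).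

Definition Linfty_norm (Omega : set E) (z : domain Omega -> R) : \bar R :=
  'N[lebesgue Omega]_+oo [EFin \o z].

Definition Linfty_ge (Omega : set E) (nu : R) : set (Linfty Omega) :=
  [set z | {ae lebesgue Omega, forall x, (nu <= z x)%R}].

End lebesgue_Rn.

(* H is a space of (classes of) functions on Omega: [repr h] is a function
   representing h, and [incl] is the inclusion of L^oo(Omega) in H. The order
   of L^oo(Omega) inherited from H is the a.e. pointwise one. *)
Record function_space (R : realType) (n : nat) (Omega : set 'rV[R]_n.+1)
    (H : hilbertType R) (Hp : set H)
    (repr : H -> {mfun domain Omega >-> R}) (incl : {linear Linfty Omega -> H}) :
    Prop := {
  repr_linear : forall (a : R) h k, {ae lebesgue Omega,
    forall x, repr (a *: h + k) x = a * repr h x + repr k x} ;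
  repr_inj : forall h k, {ae lebesgue Omega, forall x, repr h x = repr k x} ->
    h = k ;
  repr_incl : forall z : Linfty Omega,
    {ae lebesgue Omega, forall x, repr (incl z) x = z x} ;
  incl_continuous : exists C : R, forall z : Linfty Omega,
    (`|incl z|%:E <= C%:E * Linfty_norm z)%E ;
  incl_dense : dense (range incl) ;
  incl_order : forall z : Linfty Omega,
    Hp (incl z) <-> {ae lebesgue Omega, forall x, 0 <= z x}
}.

(* Main.v *)
Require Import Defs.
From HB Require Import structures.
From mathcomp Require Import all_boot all_order all_algebra ring lra.
From mathcomp Require Import all_classical all_reals all_analysis.
From mathcomp Require Import ess_sup_inf.

(* Write f_oo for the limit of f_n. The map T_f : z |-> S(f, Phi z) is increasing
   in z and in f by T-monotonicity, and m(f) is its least fixed point, hence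
   (Birkhoff) also the least z >= 0 with T_f z <= z. So y_n := m(f_n) decreases;
   as the cone is self-dual, |x - y|^2 <= |x|^2 - |y|^2 for x >= y >= 0, so that
   y_n converges in H to some y. Since (y_n) is bounded in V, y is in V and
   y_n -> y weakly in V. As y <= y_n, y satisfies all the obstacles Phi(y_n);
   testing with it gives c |y_n - y|^2 <= (f_n, y_n - y) - <A y, y_n - y> -> 0,
   hence y_n -> y in V and y = S(f_oo, Phi y), whence m(f_oo) <= y. Conversely
   f_oo >= nu gives f_n <= lambda_n f_oo with lambda_n -> 1, and by homogeneity
   lambda_n m(f_oo) is a supersolution for f_n, so that
   y <= y_n <= lambda_n m(f_oo) -> m(f_oo). *)

Set Implicit Arguments.
Unset Strict Implicit.
Unset Printing Implicit Defensive.

Import Order.TTheory GRing.Theory Num.Theory.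
Import numFieldNormedType.Exports.

Local Open Scope classical_set_scope.
Local Open Scope ring_scope.

(** * Projections and variational inequalities in a Hilbert space *)

Section hilbert.
Context (R : realType) (H : hilbertType R).
Implicit Types (x y z : H) (D K : set H).

Lemma innerDl x y z : inner (x + y) z = inner x z + inner y z.
Proof. by have := innerP 1 x y z; rewrite scale1r mul1r. Qed.

Lemma inner0l z : inner (0 : H) z = 0.
Proof. by apply: (@addrI _ (inner 0 z)); rewrite -innerDl !addr0. Qed.

Lemma innerZl (a : R) x z : inner (a *: x) z = a * inner x z.
Proof. by have := innerP a x 0 z; rewrite addr0 inner0l addr0. Qed.

Lemma innerNl x z : inner (- x) z = - inner x z.
Proof. by rewrite -scaleN1r innerZl mulN1r. Qed.

Lemma innerDr x y z : inner z (x + y) = inner z x + inner z y.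
Proof. by rewrite !(innerC z) innerDl. Qed.

Lemma inner0r z : inner z (0 : H) = 0.
Proof. by rewrite innerC inner0l. Qed.

Lemma innerZr (a : R) x z : inner z (a *: x) = a * inner z x.
Proof. by rewrite !(innerC z) innerZl. Qed.

Lemma innerNr x z : inner z (- x) = - inner z x.
Proof. by rewrite !(innerC z) innerNl. Qed.

Definition innerE := (innerDl, innerDr, innerNl, innerNr, innerZl, innerZr).

Lemma normE x : `|x| ^+ 2 = inner x x.
Proof. by rewrite inner_norm. Qed.

Lemma closed_approx D z : closed D ->
  (forall e : R, 0 < e -> exists2 x, D x & `|z - x| < e) -> D z.
Proof.
move=> cD Dz; apply: cD => B /nbhs_normP[e /= e0 Be].
by have [x Dx zx] := Dz _ e0; exists x; split => //; exact: Be.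
Qed.

Lemma closure_approx D z : closure D z ->
  forall e : R, 0 < e -> exists2 x, D x & `|z - x| < e.
Proof.
move=> cDz e e0.
have /cDz[x [Dx]] : nbhs z (ball z e) by exact: nbhsx_ballx.
by rewrite -ball_normE => ?; exists x.
Qed.

(* The hypothesis is what the parallelogram law gives with m = (x + y) / 2 for
   a convex D; it also holds with m = inf (x, y) for a set D of nonnegative
   elements that is stable under inf. *)
Lemma min_norm_closure D : D !=set0 ->
  (forall x y, D x -> D y ->
     exists2 m, D m & `|x - y| ^+ 2 + 4 * `|m| ^+ 2 <= 2 * `|x| ^+ 2 + 2 * `|y| ^+ 2) ->
  exists2 z, closure D z & forall d, D d -> `|z| <= `|d|.
Proof.
move=> [d0 Dd0] Dmid; pose N := [set `|x| ^+ 2 | x in D].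
have infN : has_inf N.
  by split; [exists (`|d0| ^+ 2), d0|exists 0 => _ [x _ <-]; exact: sqr_ge0].
have leN x : D x -> inf N <= `|x| ^+ 2.
  by move=> Dx; apply: ge_inf; [exact: infN.2|exists x].
(* The near-minimizers of the squared norm on [D] generate this filter, and [z] is its limit. *)
pose F := filter_from [set e : R | 0 < e] (fun e => D `&` [set x | `|x| ^+ 2 < inf N + e]).
have FF : ProperFilter F.
  apply: filter_from_proper.
    apply: filter_from_filter; first by exists 1 => /=.
    move=> e1 e2 /= e10 e20; exists (Num.min e1 e2) => /=; first by rewrite lt_min e10.
    by move=> x /= [Dx]; rewrite -ltrBlDl lt_min => /andP[? ?]; split; split => //; lra.
  by move=> e /= e0; have [_ [x Dx <-] xe] := inf_adherent e0 infN; exists x.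
have Fcvg : cvg F.
  apply/cauchy_cvgP/cauchy_exP => e e0.
  (* Since |m|^2 >= inf N, the hypothesis bounds |x - y|^2 by 2 (|x|^2 - inf N) + 2 (|y|^2 - inf N),
     which is below e^2 once both excesses are below e^2 / 4. *)
  have e1 : 0 < e ^+ 2 / 4 by rewrite divr_gt0 ?exprn_gt0.
  have [_ [x Dx <-] xe] := inf_adherent e1 infN; exists x; exists (e ^+ 2 / 4) => //=.
  move=> y [Dy /= ye]; rewrite -ball_normE /=.
  have [m Dm] := Dmid x y Dx Dy; have := leN m Dm.
  by rewrite -(@ltr_pXn2r _ 2) ?nnegrE ?(ltW e0)//; lra.
exists (lim F).
  move=> B /Fcvg[e /= e0 Be]; have [_ [x Dx <-] xe] := inf_adherent e0 infN.
  by exists x; split=> //; exact: Be.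
move=> d Dd; rewrite -(@ler_pXn2r _ 2) ?nnegrE//; apply: (le_trans _ (leN _ Dd)).
apply/ler_addgt0Pr => e e0.
have cF : `|x| ^+ 2 @[x --> F] --> `|lim F| ^+ 2.
  by rewrite expr2; apply: cvgM; apply: cvg_norm; exact: Fcvg.
rewrite -(cvg_lim _ cF)//; apply: limr_le; first by apply/cvg_ex; exists (`|lim F| ^+ 2).
by exists e => //= x [_ /ltW].
Qed.

Definition segment_convex D := forall x y (t : R), D x -> D y -> 0 <= t <= 1 ->
  D (x + t *: (y - x)).

(** A translation by -x reduces this to an element w of least norm; the inequality is the
    first-order condition for minimality along the segments issued from w + x. *)
Lemma projection_exists K x : closed K -> segment_convex K -> K !=set0 ->
  exists2 p, K p & forall z, K z -> inner (x - p) (z - p) <= 0.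
Proof.
move=> cK vK [k0 Kk0]; pose D := [set k - x | k in K].
have [|_ _ [k1 K1 <-] [k2 K2 <-]|w cw wmin] := @min_norm_closure D.
- by exists (k0 - x), k0.
- exists (k1 + 2^-1 *: (k2 - k1) - x).
    by exists (k1 + 2^-1 *: (k2 - k1)) => //; apply: vK => //; lra.
  by rewrite !normE !innerE (innerC k2 k1) (innerC x k1) (innerC x k2); lra.
have Kp : K (w + x).
  apply: (closed_approx cK) => e e0.
  have [_ [k Kk <-]] := closure_approx cw e0.
  by rewrite opprB addrA => ?; exists k.
exists (w + x) => // z Kz.
have -> : x - (w + x) = - w by rewrite opprD addrCA subrr addr0.
have := fun t : R => @vK _ _ t Kp Kz; rewrite innerNl oppr_le0.
move: (z - _) => v Kv; rewrite leNgt; apply/negP => wv0.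
have wv (t : R) : 0 <= t <= 1 -> 0 <= t * (2 * inner w v + t * `|v| ^+ 2).
  move=> t01; have /wmin : D (w + x + t *: v - x) by exists (w + x + t *: v) => //; exact: Kv.
  rewrite addrAC addrK -(@ler_pXn2r _ 2) ?nnegrE// !normE !innerE (innerC v w); lra.
(* If (w, v) < 0, this t lies in (0, 1], also when |v| is small compared with -(w, v), and 2 (w, v)
   + t |v|^2 = (1 + t) (w, v) < 0, against minimality. *)
pose t := - inner w v / (`|v| ^+ 2 - inner w v).
have v0 := sqr_ge0 `|v|; have d0 : 0 < `|v| ^+ 2 - inner w v by lra.
have tE : t * (`|v| ^+ 2 - inner w v) = - inner w v by rewrite /t divfK// gt_eqF.
have t0 : 0 < t by rewrite /t divr_gt0// oppr_gt0.
have t1 : t <= 1 by rewrite /t ler_pdivrMr//; lra.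
have := wv t; rewrite (ltW t0) t1 => /(_ isT); rewrite pmulr_rge0//.
nra.
Qed.

End hilbert.

Section monotone_operators.
Context (R : realType) (V : hilbertType R).
Implicit Types (u v w x y z : V) (K : set V).

(** On a subspace, the test elements p + k and p - k turn the variational inequality of the
    projection into an equality. *)
Lemma orthogonal_projection K x : closed K -> K 0 ->
  (forall (a : R) y z, K y -> K z -> K (a *: y + z)) ->
  exists2 p, K p & forall k, K k -> inner (x - p) k = 0.
Proof.
move=> cK K0 lK.
have [||p Kp pP] := projection_exists x cK; [|by exists 0|].
  move=> y z t Ky Kz _; rewrite addrC; apply: (lK t _ y) => //.
  by rewrite addrC -scaleN1r; exact: lK.
exists p => // k Kk; apply/eqP; rewrite eq_le; apply/andP; split.
  by have := pP _ (lK 1 k p Kk Kp); rewrite scale1r addrK.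
by have := pP _ (lK (-1) k p Kk Kp); rewrite scaleN1r addrK innerNr oppr_le0.
Qed.

Lemma riesz (f : V -> R) : linear_for *%R f -> continuous f ->
  exists u, forall v, f v = inner u v.
Proof.
move=> lf cf; have [f0|] := pselect (forall v, f v = 0).
  by exists 0 => v; rewrite inner0l.
move=> /existsNP[u0 /eqP fu0].
have f0 : f 0 = 0.
  by apply: (@addrI _ (f 0)); have := lf 1 0 0; rewrite scale1r mul1r !addr0.
have cK : closed [set v | f v = 0].
  have := @preimage_closed _ _ f [set 0 : R] (in1W cf); apply.
  exact: closed_eq.
have [a y z /= fy fz|p fp pP] := orthogonal_projection u0 cK f0.
  by rewrite lf fy fz mulr0 addr0.
pose w := u0 - p.
have fw : f w = f u0.
  by rewrite /w addrC -scaleN1r lf fp mulr0 add0r.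
have w0 : inner w w != 0.
  rewrite -normE expf_neq0// normr_eq0; apply: contraNneq fu0 => w0.
  by rewrite -fw w0 f0.
exists ((f w / inner w w) *: w) => v; rewrite innerZl.
(* The vector f(v) w - f(w) v is in the kernel of [f], to which w is orthogonal. *)
have : inner w (f v *: w + (- f w) *: v) = 0.
  apply: pP => /=.
  by rewrite lf -[_ *: v]addr0 lf f0; ring.
rewrite innerDr !innerZr => h; apply: (mulIf w0).
by rewrite mulrAC divfK//; lra.
Qed.

(** With P the projection onto [K], the solutions are the fixed points of y |-> P (y - rho (b y -
    u0)) for any rho > 0; Banach's theorem applies for a suitable rho. *)
Lemma lions_stampacchia K (b : V -> V) u0 (c C : R) :
  closed K -> segment_convex K -> K !=set0 -> 0 < c ->
  (forall u v, c * `|u - v| ^+ 2 <= inner (b u - b v) (u - v)) ->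
  (forall u v, `|b u - b v| <= C * `|u - v|) ->
  exists2 y, K y & forall v, K v -> 0 <= inner (b y - u0) (v - y).
Proof.
move=> cK vK K0 c0 bmon blip.
have /choice[P PP] : forall x, exists p, K p /\ forall z, K z -> inner (x - p) (z - p) <= 0.
  by move=> x; have [p ? ?] := projection_exists x cK vK K0; exists p.
(* Adding c makes L a positive Lipschitz constant with c <= L, which puts q2 = 1 - c^2 / L^2 in [0,
   1). *)
pose L := `|C| + c; have L0 : 0 < L by rewrite ltr_wpDl.
have bL u v : `|b u - b v| ^+ 2 <= L ^+ 2 * `|u - v| ^+ 2.
  rewrite -exprMn lerXn2r ?nnegrE ?mulr_ge0 ?(ltW L0)//.
  apply: (le_trans (blip u v)); rewrite ler_wpM2r// /L.
  by have := ler_norm C; lra.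
(* This rho minimizes 1 - 2 c rho + L^2 rho^2, the bound on the squared contraction factor; the
   minimum is q2. *)
pose rho := c / L ^+ 2; pose q2 := 1 - c * rho.
have L20 : 0 < L ^+ 2 by rewrite exprn_gt0.
have rho0 : 0 < rho by rewrite divr_gt0.
have rhoL : rho * L ^+ 2 = c by rewrite /rho divfK// gt_eqF.
have q20 : 0 <= q2.
  rewrite subr_ge0 /rho mulrA ler_pdivrMr// mul1r -expr2 lerXn2r ?nnegrE ?(ltW c0) ?(ltW L0)//.
  by rewrite /L lerDr.
have q21 : q2 < 1 by rewrite ltrBlDr ltrDl mulr_gt0.
pose G y := P (y - rho *: b y + rho *: u0).
have GG : set_fun [set: V] [set: V] G by [].
have q1 : Num.sqrt q2 < 1 by rewrite -[ltRHS]sqrtr1 ltr_sqrt.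
have Pne x z : `|P x - P z| ^+ 2 <= `|x - z| ^+ 2.
  have [KPx /(_ _ (PP z).1) Px] := PP x; have [KPz /(_ _ KPx) Pz] := PP z.
  have := sqr_ge0 `|(x - z) - (P x - P z)|.
  move: Px Pz; move: (P x) (P z) => p q; rewrite !normE !innerE.
  rewrite (innerC p x) (innerC p z) (innerC q x) (innerC q z) (innerC p q) (innerC z x); lra.
have ctr : is_contraction (mkfun_fun GG).
  exists (NngNum (sqrtr_ge0 q2)); split=> //= -[u v] _ /=.
  rewrite -(@ler_pXn2r _ 2) ?nnegrE ?mulr_ge0 ?sqrtr_ge0// exprMn sqr_sqrtr//.
  apply: (le_trans (Pne _ _)).
  have h1 := bmon u v; have h2 := bL u v.
  have -> : u - rho *: b u + rho *: u0 - (v - rho *: b v + rho *: u0) =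
      (u - v) - rho *: (b u - b v).
    by rewrite opprD addrACA subrr addr0 opprD addrACA -opprD -scalerBr.
  move: (u - v) (b u - b v) h1 h2 => d e.
  rewrite -(ler_pM2l rho0) => h1; rewrite -(ler_pM2l (exprn_gt0 2 rho0)) => h2.
  rewrite [X in X <= _]normE !innerE (innerC d e) -!normE /q2.
  have -> : (1 - c * rho) * `|d| ^+ 2 =
      `|d| ^+ 2 - 2 * (rho * (c * `|d| ^+ 2)) + rho ^+ 2 * (L ^+ 2 * `|d| ^+ 2).
    by rewrite -rhoL; ring.
  lra.
have [|y _ yE] := banach_fixed_point ctr closedT; first by exists 0.
have [] := PP (y - rho *: b y + rho *: u0).
rewrite -/(G y) -[G y]yE => Ky yP; exists y => // v /yP.
have -> : y - rho *: b y + rho *: u0 - y = - rho *: (b y - u0).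
  by rewrite addrAC [y - _ - y]addrAC subrr add0r scalerBr !scaleNr opprK.
by rewrite innerZl mulNr oppr_le0 pmulr_rge0.
Qed.


End monotone_operators.

(** * Duality and weak limits *)

Section dual.
Context (R : realType) (V : hilbertType R).
Implicit Types (g h : dual V) (u v : V).

Lemma dual_riesz g : exists u, forall v, g v = inner u v.
Proof. by have := dual_funP g; rewrite inE => -[lg cg]; exact: riesz. Qed.

Lemma dualB g h v : (g - h) v = g v - h v.
Proof. by []. Qed.

Lemma dualZ (a : R) g v : (a *: g) v = a * g v.
Proof. by []. Qed.

Lemma dualE g h : (forall v, g v = h v) -> g = h.
Proof. by move=> gh; apply/val_inj/funext. Qed.

Lemma dual0 g : g 0 = 0.
Proof. by have [u ->] := dual_riesz g; rewrite inner0r. Qed.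

Lemma dualNr g v : g (- v) = - g v.
Proof. by have [w wP] := dual_riesz g; rewrite !wP innerNr. Qed.

Lemma dualZr g (a : R) v : g (a *: v) = a * g v.
Proof. by have [w wP] := dual_riesz g; rewrite !wP innerZr. Qed.

(** [dual_norm] is a supremum of reals, so the set must first be shown bounded: the norm of the
    Riesz representative bounds it. *)
Lemma le_dual_norm g v : `|g v| <= dual_norm g * `|v|.
Proof.
have [->|v0] := eqVneq v 0; first by rewrite dual0 !normr0 mulr0.
have nv : 0 < `|v| by rewrite normr_gt0.
rewrite -ler_pdivrMr//; apply: ub_le_sup.
  have [u uP] := dual_riesz g; exists `|u| => _ [w /= w1 <-].
  rewrite uP; apply: (le_trans (norm_inner_le _ _)).
  by rewrite ler_piMr.
exists (`|v|^-1 *: v) => /=.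
  by rewrite normrZ normfV normr_id mulVf// gt_eqF.
by rewrite dualZr normrM normfV normr_id mulrC.
Qed.

(** Polarization reduces the joint continuity of the inner product to that of the norm. *)
Lemma cvg_inner T (F : set_system T) (FF : Filter F) (u v : T -> V) (a b : V) :
  u @ F --> a -> v @ F --> b -> inner (u x) (v x) @[x --> F] --> inner a b.
Proof.
have polar (x y : V) : inner x y = 4^-1 * (`|x + y| * `|x + y| - `|x - y| * `|x - y|).
  by rewrite -!expr2 !normE !innerE (innerC y x); field.
move=> ua vb; rewrite polar; under eq_fun do rewrite polar.
apply: cvgMl_tmp; apply: cvgB.
  by apply: cvgM; apply: cvg_norm; apply: cvgD.
by apply: cvgM; apply: cvg_norm; apply: cvgB.
Qed.

End dual.

Section weak_limit.
Context (R : realType) (V H : hilbertType R) (i : gelfand_embedding V H).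

(* The functionals v |-> (k, i v), k in H, are dense in the dual of V since i
   is injective; on them the sequence converges, and its boundedness carries
   this over to all functionals. *)
Lemma weak_limit (y : nat -> V) (B : R) (h : H) :
  (forall n, `|y n| <= B) -> i (y n) @[n --> \oo] --> h ->
  exists2 p, i p = h & forall u, inner u (y n) @[n --> \oo] --> inner u p.
Proof.
move=> yB yh; pose C := `|B| + 1; have C0 : 0 < C by rewrite ltr_wpDl.
have yC n : `|y n| <= C.
  by apply: (le_trans (yB n)); have := ler_norm B; rewrite /C; lra.
have cvgk k : inner k (i (y n)) @[n --> \oo] --> inner k h.
  by apply: cvg_inner => //; exact: cvg_cst.
pose Y := [set u | cvg (inner u (y n) @[n --> \oo])].
have linY (a : R) u v lu lv :
      inner u (y n) @[n --> \oo] --> lu -> inner v (y n) @[n --> \oo] --> lv ->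
    inner (a *: u + v) (y n) @[n --> \oo] --> a * lu + lv.
  move=> ulu vlv; under eq_fun do rewrite innerDl innerZl.
  by apply: cvgD => //; exact: cvgMl_tmp.
have cY : closed Y.
  move=> u cu; apply/cauchy_cvgP/cauchy_exP => e e0.
  have [|w Yw uw] := @closure_approx _ _ _ _ cu (e / 2 / C); first by rewrite !divr_gt0.
  exists (lim (inner w (y n) @[n --> \oo])).
  have : \forall n \near \oo, `|lim (inner w (y n) @[n --> \oo]) - inner w (y n)| < e / 2.
    by move/cvgrPdist_lt : Yw; apply; rewrite divr_gt0.
  apply: filterS => n wn; rewrite -ball_normE /=.
  have := norm_inner_le (u - w) (y n); rewrite innerDl innerNl => uwn.
  have : `|u - w| * `|y n| <= e / 2.
    apply: (@le_trans _ _ (`|u - w| * C)); first by rewrite ler_wpM2l.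
    by rewrite -ler_pdivlMr// ltW.
  move: wn uwn; rewrite distrC => + + uwe.
  move=> /ltr_normlP[? ?] /ler_normlP[? ?].
  by apply/ltr_normlP; split; lra.
have YT u : Y u.
  have Y0 : Y 0.
    by apply/cvg_ex; exists 0; under eq_fun do rewrite inner0l; exact: cvg_cst.
  have [|p Yp pP] := orthogonal_projection u cY Y0.
    move=> a v w Yv Yw; apply/cvg_ex; eexists; apply: linY; [exact: Yv|exact: Yw].
  (* The residual u - p is orthogonal to [Y], which contains the representative q of v |-> (i (u -
     p), i v); hence |i (u - p)|^2 = (q, u - p) = 0. *)
  suff : u - p = 0 by move/eqP; rewrite subr_eq0 => /eqP ->.
  apply: (@emb_inj _ _ _ i); rewrite linear0.
  have [q qP] := dual_riesz (pivot i (i (u - p))).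
  have Yq : Y q.
    apply/cvg_ex; exists (inner (i (u - p)) h).
    by under eq_fun do rewrite -qP; exact: cvgk.
  apply/eqP; rewrite -normr_eq0 -sqrf_eq0 normE.
  have -> : inner (i (u - p)) (i (u - p)) = pivot i (i (u - p)) (u - p) by [].
  by rewrite qP innerC pP.
pose l u := lim (inner u (y n) @[n --> \oo]).
have [|u|p lp] := @riesz _ _ l.
- by move=> a u v; apply: cvg_lim => //; apply: linY; exact: YT.
- have lB v : `|l v| <= C * `|v|.
    rewrite -(cvg_lim _ (cvg_norm (YT v)))//.
    apply: limr_le; first by apply: is_cvg_norm; exact: YT.
    apply: nearW => n; apply: (le_trans (norm_inner_le _ _)).
    by rewrite mulrC ler_wpM2r.
  have lN v w : l v - l w = l (v - w).
    apply/esym/cvg_lim => //; under eq_fun do rewrite innerDl innerNl.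
    by apply: cvgB; exact: YT.
  apply/cvgrPdist_lt => e e0; near=> v; rewrite lN.
  apply: (le_lt_trans (lB _)); rewrite mulrC -ltr_pdivlMr//.
  near: v; apply: cvgr_dist_lt; first exact: cvg_id.
  by rewrite divr_gt0.
exists p => [|u]; last by rewrite innerC -lp; exact: YT.
(* With k = i p - h, both (k, i p) and (k, h) are the limit of (k, i (y n)), so that |k|^2 = 0. *)
apply/eqP; rewrite -subr_eq0 -normr_eq0 -sqrf_eq0 normE.
set k := i p - h; rewrite [inner k _]innerDr innerNr.
have [q qP] := dual_riesz (pivot i k).
have -> : inner k (i p) = pivot i k p by [].
rewrite qP innerC -lp subr_eq0; apply/eqP.
apply: cvg_lim => //; under eq_fun do rewrite -qP; exact: cvgk.
Unshelve. all: by end_near. Qed.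

End weak_limit.

(** * Order completeness *)

Section ordered_hilbert.
Context (R : realType) (H : hilbertType R) (Hp : set H).
Hypotheses (coneHp : self_dual_cone Hp) (supHp : sup_is_supremum Hp).
Implicit Types x y z w : H.

Let closedHp : closed Hp. Proof. by case: coneHp. Qed.

Lemma cone_add x y : Hp x -> Hp y -> Hp (x + y).
Proof. by case: coneHp => _ + _ _; apply. Qed.

Lemma cone_scale (t : R) x : 0 <= t -> Hp x -> Hp (t *: x).
Proof. by case: coneHp => _ _ + _; apply. Qed.

Lemma cone_inner x y : Hp x -> Hp y -> 0 <= inner x y.
Proof. by case: coneHp => _ _ _ {1}-> + Hy; exact. Qed.

Lemma coneP x : (forall y, Hp y -> 0 <= inner x y) -> Hp x.
Proof. by move=> h; case: coneHp => _ _ _ ->. Qed.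

Lemma cone0 : Hp 0.
Proof. by apply: coneP => y _; rewrite inner0l. Qed.

Lemma leH0 x : leH Hp 0 x <-> Hp x.
Proof. by rewrite /leH subr0. Qed.

Lemma leH_refl x : leH Hp x x.
Proof. by rewrite /leH subrr; exact: cone0. Qed.

Lemma leH_trans y x z : leH Hp x y -> leH Hp y z -> leH Hp x z.
Proof.
by rewrite /leH => xy yz; rewrite -(subrK y z) -addrA; exact: cone_add.
Qed.

Lemma leH_anti x y : leH Hp x y -> leH Hp y x -> x = y.
Proof.
rewrite /leH => xy yx; apply/eqP; rewrite -subr_eq0 -normr_eq0 -sqrf_eq0 eq_le.
rewrite sqr_ge0 andbT normE.
by have := cone_inner yx xy; rewrite -[y - x]opprB innerNr oppr_ge0.
Qed.

Lemma leH_ge0 x y : Hp x -> leH Hp x y -> Hp y.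
Proof. by move=> /leH0 x0 /(leH_trans x0)/leH0. Qed.

(** After expansion this is (x, y - x) >= 0, an inner product of two elements of the cone. *)
Lemma leH_norm x y : Hp x -> leH Hp x y -> `|y - x| ^+ 2 <= `|y| ^+ 2 - `|x| ^+ 2.
Proof.
move=> Hx xy; have := cone_inner Hx xy.
by rewrite !normE !innerE (innerC y x); lra.
Qed.

Lemma leH_dist z x y : leH Hp z x -> leH Hp x y -> `|x - z| <= `|y - z|.
Proof.
move=> zx xy; rewrite -(@ler_pXn2r _ 2) ?nnegrE//.
have : leH Hp (x - z) (y - z) by rewrite /leH opprB addrA subrK.
by move/(leH_norm zx); have := sqr_ge0 `|y - z - (x - z)|; lra.
Qed.

(** This and the next two properties are those of the supremum of 0 and x, because [supH] 0 x
    reduces to [pos] x. *)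
Lemma pos_ge0 x : Hp (pos Hp x).
Proof. by have [+ _ _] := supHp 0 x; rewrite /leH /supH subr0 add0r subr0. Qed.

Lemma pos_ge x : leH Hp x (pos Hp x).
Proof. by have [_ + _] := supHp 0 x; rewrite /supH subr0 add0r. Qed.

Lemma pos_least x z : Hp z -> leH Hp x z -> leH Hp (pos Hp x) z.
Proof.
by move=> /leH0 Hz xz; have [_ _] := supHp 0 x; rewrite /supH subr0 add0r; apply.
Qed.

Lemma pos_id x : Hp x -> pos Hp x = x.
Proof.
move=> Hx; apply: leH_anti (pos_ge x).
by apply: pos_least => //; exact: leH_refl.
Qed.

Lemma pos_le x y : leH Hp x y -> leH Hp (pos Hp x) (pos Hp y).
Proof.
move=> xy; apply: pos_least; first exact: pos_ge0.
exact: leH_trans xy (pos_ge y).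
Qed.

Lemma pos_eq0 x : leH Hp x 0 -> pos Hp x = 0.
Proof.
move=> x0; apply: leH_anti; first by apply: pos_least => //; exact: cone0.
by apply/leH0; exact: pos_ge0.
Qed.

Definition infH x y := x - pos Hp (x - y).

Lemma infH_lel x y : leH Hp (infH x y) x.
Proof. by rewrite /leH /infH opprB addrCA subrr addr0; exact: pos_ge0. Qed.

Lemma infH_ler x y : leH Hp (infH x y) y.
Proof. by have := pos_ge (x - y); rewrite /leH /infH !opprB addrCA. Qed.

Lemma infH_ge w x y : leH Hp w x -> leH Hp w y -> leH Hp w (infH x y).
Proof.
move=> wx wy; have := @pos_least (x - y) (x - w) wx.
have h : leH Hp (x - y) (x - w) by rewrite /leH opprB addrC addrA subrK.
by move=> /(_ h); rewrite /leH /infH addrAC.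
Qed.

Lemma closed_lower x : closed (leH Hp x).
Proof.
have := @preimage_closed _ _ (fun z : H => z - x) Hp _ closedHp; apply.
by move=> z _; apply: cvgB; [exact: cvg_id|exact: cvg_cst].
Qed.

Lemma closed_upper y : closed [set x | leH Hp x y].
Proof.
have := @preimage_closed _ _ (fun z : H => y - z) Hp _ closedHp; apply.
by move=> z _; apply: cvgB; [exact: cvg_cst|exact: cvg_id].
Qed.

(** The infimum is the element z of least norm in the closure. For x in [D] close to z and m = inf
    (x, d), minimality gives |x - m|^2 <= |x|^2 - |m|^2 <= |x|^2 - |z|^2, so that z is a limit of
    elements below d. *)
Lemma inf_stable_infimum (D : set H) : D !=set0 -> D `<=` Hp ->
  (forall x y, D x -> D y -> D (infH x y)) ->
  exists z, [/\ closure D z, (forall d, D d -> leH Hp z d) &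
    forall w, (forall d, D d -> leH Hp w d) -> leH Hp w z].
Proof.
move=> D0 DHp Dinf.
have [x y Dx Dy|z cz zmin] := min_norm_closure D0.
  exists (infH x y); first exact: Dinf.
  have Hm := DHp _ (Dinf _ _ Dx Dy).
  have := leH_norm Hm (infH_lel x y); have := leH_norm Hm (infH_ler x y).
  have : `|x - y| ^+ 2 + `|(x - infH x y) + (y - infH x y)| ^+ 2 =
      2 * `|x - infH x y| ^+ 2 + 2 * `|y - infH x y| ^+ 2.
    move: (infH x y) => m; rewrite !normE !innerE.
    by rewrite (innerC y x) (innerC m x) (innerC m y); ring.
  have := sqr_ge0 `|(x - infH x y) + (y - infH x y)|; lra.
exists z; split => // [d Dd|w wD]; last first.
  apply: closed_approx (@closed_lower w) _ => e e0.
  by have [x Dx zx] := closure_approx cz e0; exists x => //; exact: wD.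
apply: closed_approx (@closed_upper d) _ => e e0.
(* The second bound gives |x|^2 - |z|^2 <= s (2 |z| + s) <= s (2 |z| + e) <= e^2 / 4, hence |x - inf
   (x, d)| <= e / 2; the first gives |z - x| < e / 2. *)
pose s := Num.min (e / 2) (e ^+ 2 / (4 * (2 * `|z| + e))).
have ze : 0 < 2 * `|z| + e by rewrite ltr_wpDl// mulr_ge0.
have s0 : 0 < s by rewrite lt_min !divr_gt0// ?exprn_gt0// mulr_gt0.
have [x Dx zx] := closure_approx cz s0.
exists (infH x d); first exact: infH_ler.
have Dm := Dinf _ _ Dx Dd.
have /andP[se2 s4] : (s <= e / 2) && (s <= e ^+ 2 / (4 * (2 * `|z| + e))).
  by rewrite -le_min lexx.
have xz : `|x| <= `|z| + s.
  by rewrite -[x](subrK z) addrC (le_trans (ler_normD _ _))// lerD2l distrC ltW.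
have xm : `|x - infH x d| <= e / 2.
  have e20 : 0 <= e / 2 by rewrite divr_ge0 ?(ltW e0).
  rewrite -(@ler_pXn2r _ 2) ?nnegrE//.
  apply: (le_trans (leH_norm (DHp _ Dm) (infH_lel x d))).
  have : `|z| ^+ 2 <= `|infH x d| ^+ 2 by rewrite lerXn2r ?nnegrE ?zmin.
  have : `|x| ^+ 2 <= (`|z| + s) ^+ 2.
    by rewrite lerXn2r ?nnegrE ?addr_ge0 ?(ltW s0).
  move: s4; rewrite ler_pdivlMr ?mulr_gt0// => s4.
  have : s * s <= s * e by rewrite ler_pM2l//; lra.
  by rewrite expr_div_n; nra.
rewrite -(subrK x z) -addrA (le_lt_trans (ler_normD _ _))//; lra.
Qed.

(** The range of a decreasing sequence is stable under inf. Its infimum is in the closure of the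
    range, and by [leH_dist] the distance to it never increases along the sequence. *)
Lemma decreasing_cvg (z : nat -> H) : (forall n, Hp (z n)) ->
  (forall n, leH Hp (z n.+1) (z n)) ->
  exists l, [/\ z @ \oo --> l, Hp l & forall n, leH Hp l (z n)].
Proof.
move=> z0 zdec.
have zmono m n : (m <= n)%N -> leH Hp (z n) (z m).
  elim: n => [|n IH]; first by rewrite leqn0 => /eqP ->; exact: leH_refl.
  rewrite leq_eqVlt => /predU1P[->|]; first exact: leH_refl.
  by move=> /IH; exact: leH_trans.
have [||_ _ [m _ <-] [n _ <-]|l [cl lz lmax]] := @inf_stable_infimum (range z).
- by exists (z 0%N), 0%N.
- by move=> _ [n _ <-].
- have [mn|/ltnW nm] := leqP m n.
    exists n => //; rewrite /infH pos_id ?subKr//.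
    exact: zmono.
  exists m => //; rewrite /infH pos_eq0 ?subr0//.
  by rewrite /leH sub0r opprB; exact: zmono.
exists l; split => [||n]; last by apply: lz; exists n.
  apply/cvgrPdist_lt => e e0.
  have [_ [N _ <-] lN] := closure_approx cl e0.
  exists N => // n /= Nn; rewrite distrC in lN; rewrite distrC.
  apply: le_lt_trans lN; apply: leH_dist; last exact: zmono.
  by apply: lz; exists n.
by apply/leH0; apply: lmax => _ [n _ <-]; apply/leH0.
Qed.

(* The set of nonnegative z with T z <= z is stable under inf, so that its
   infimum belongs to it. *)
Lemma least_prefixed_point (T : H -> H) :
  (forall z, Hp z -> Hp (T z)) ->
  (forall x y, Hp x -> leH Hp x y -> leH Hp (T x) (T y)) ->
  (exists2 z, Hp z & leH Hp (T z) z) ->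
  exists z, [/\ Hp z, z = T z & forall w, Hp w -> leH Hp (T w) w -> leH Hp z w].
Proof.
move=> T0 Tle [z0 Hz0 Tz0]; pose D := [set z | Hp z /\ leH Hp (T z) z].
have [||x y [Hx Tx] [Hy Ty]|z [cz zD zmax]] := @inf_stable_infimum D.
- by exists z0.
- by move=> z [].
- have Hm : Hp (infH x y) by apply/leH0/infH_ge; exact/leH0.
  split => //; apply: infH_ge.
    by apply: leH_trans Tx; apply: Tle => //; exact: infH_lel.
  by apply: leH_trans Ty; apply: Tle => //; exact: infH_ler.
have Hz : Hp z by apply/leH0; apply: zmax => d [Hd _]; exact/leH0.
have Tz : leH Hp (T z) z.
  apply: zmax => d Dd; case: (Dd) => _; apply: leH_trans.
  by apply: Tle => //; exact: zD.
exists z; split => // [|w Hw Tw]; last exact: zD.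
(* Monotonicity makes T z another element of [D], whence z <= T z. *)
apply: leH_anti (Tz); apply: zD; split; first exact: T0.
by apply: Tle => //; exact: T0.
Qed.

End ordered_hilbert.

(** * The obstacle problem *)

Section variational_inequality.
Context (R : realType) (V : hilbertType R) (A : V -> dual V).
Hypotheses (homA : homogeneous1 A) (lipA : lipschitz_dual A)
  (monA : strongly_monotone A).
Implicit Types (f g : dual V) (u v w y : V).

Lemma operator0 : A 0 = 0.
Proof.
apply: dualE => v; have -> : (0 : dual V) v = 0 by [].
have := homA (0 : V) (ltr0n R 2); rewrite scaler0.
by move/(congr1 (fun h : dual V => h v)); rewrite dualZ; lra.
Qed.

(** Carries the operator from V' over to V, where [lions_stampacchia] applies. *)
Lemma operator_riesz : exists b : V -> V, exists C : R,
  (forall u v, A u v = inner (b u) v) /\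
  forall u v, `|b u - b v| <= C * `|u - v|.
Proof.
have [C AC] := lipA; have /choice[b bP] := fun u => dual_riesz (A u).
exists b, `|C|; split => // u v.
set d := b u - b v; have [->|d0] := eqVneq d 0.
  by rewrite normr0 mulr_ge0.
rewrite -(@ler_pM2r _ `|d|) ?normr_gt0// -expr2 normE.
have -> : inner d d = (A u - A v) d.
  by rewrite dualB !bP /d [LHS]innerDl innerNl.
apply: (le_trans (ler_norm _)); apply: (le_trans (le_dual_norm _ _)).
rewrite ler_wpM2r//; apply: (le_trans (AC u v)).
by rewrite ler_wpM2r// ler_norm.
Qed.

(** A general [K] covers both the obstacle problem and, with [K] the whole space, the equation A y =
    f. *)
Definition VI f (K : set V) y :=
  K y /\ forall v, K v -> 0 <= (A y - f) (v - y).

Lemma VI_exists f (K : set V) : closed K -> segment_convex K -> K !=set0 ->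
  exists y, VI f K y.
Proof.
move=> cK vK K0; have [b [C [bP bC]]] := operator_riesz.
have [c c0 Ac] := monA; have [u0 u0P] := dual_riesz f.
have [|y Ky yP] := @lions_stampacchia _ _ K b u0 c C cK vK K0 c0 _ bC.
  by move=> u v; rewrite innerDl innerNl -!bP -dualB; exact: Ac.
exists y; split => // v /yP.
by rewrite dualB bP u0P innerDl innerNl.
Qed.

Lemma VI_unique f (K : set V) y1 y2 : VI f K y1 -> VI f K y2 -> y1 = y2.
Proof.
move=> [K1 h1] [K2 h2]; have [c c0 Ac] := monA.
have := Ac y1 y2; have := h1 _ K2; have := h2 _ K1.
rewrite -(opprB y1 y2) !dualB !dualNr => h3 h4 h5.
apply/eqP; rewrite -subr_eq0 -normr_eq0 -sqrf_eq0 eq_le sqr_ge0 andbT.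
by rewrite -(pmulr_rle0 _ c0); lra.
Qed.

(** Without constraint, y + v and y - v are both admissible, and the inequality becomes an
    equation. *)
Lemma stateP f : A (state A f) = f.
Proof.
rewrite /state; apply: (@xgetPex _ 0 [set y | A y = f]).
have [||y [_ yP]] := @VI_exists f setT closedT.
- by [].
- by exists 0.
exists y; apply: dualE => v.
have := yP (y + v) I; have := yP (y - v) I.
rewrite ![y + _ - y]addrAC subrr !add0r !dualB !dualNr => h1 h2.
by apply/eqP; rewrite eq_le; apply/andP; split; lra.
Qed.

End variational_inequality.

Section obstacle.
Context (R : realType) (V H : hilbertType R) (i : gelfand_embedding V H).
Variables (Hp : set H) (A : V -> dual V).
Hypotheses (coneHp : self_dual_cone Hp) (supHp : sup_is_supremum Hp).
Hypotheses (posHp : pos_stable i Hp).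
Hypotheses (homA : homogeneous1 A) (lipA : lipschitz_dual A)
  (monA : strongly_monotone A) (TA : T_monotone i Hp A).
Implicit Types (f g F : dual V) (u v w y : V) (psi phi : H).

Local Notation S := (VI_solution i Hp A).
Local Notation K := (obstacle_set i Hp).

Lemma posVE v : i (posV i Hp v) = pos Hp (i v).
Proof.
rewrite /posV; apply: (@xgetPex _ 0 [set w | i w = pos Hp (i v)]).
by have [w _ wE] := posHp.1 v; exists w.
Qed.

Lemma obstacle_VI_unique f psi y : VI A f (K psi) y -> y = S f psi.
Proof.
move=> yP; apply: (VI_unique monA yP).
by apply: (@xgetPex _ 0 (VI A f (K psi))); exists y.
Qed.

Lemma VI_solutionP f psi : Hp psi -> VI A f (K psi) (S f psi).
Proof.
move=> Hpsi; apply: (@xgetPex _ 0 (VI A f (K psi))).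
apply: VI_exists => //.
- have := @preimage_closed _ _ i [set x | leH Hp x psi] _ (closed_upper coneHp (y := psi)).
  by apply; move=> v _; exact: emb_continuous.
- move=> u v t; rewrite /obstacle_set /= /leH => Ku Kv /andP[t0 t1].
  have -> : psi - i (u + t *: (v - u)) = (1 - t) *: (psi - i u) + t *: (psi - i v).
    have -> : psi - i v = (psi - i u) - (i v - i u) by rewrite opprB addrA subrK.
    rewrite linearD linearZ linearB opprD addrA scalerBl scale1r.
    by rewrite [t *: (_ - (_ - _))]scalerBr addrA subrK.
  by apply: cone_add => //; apply: cone_scale => //; rewrite subr_ge0.
- by exists 0; rewrite /obstacle_set /= linear0; exact/leH0.
Qed.

(** The comparison principle. For p = (y - w)^+ the hypotheses give A(y) p <= f p <= g p <= A(w) p,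
    which is the equality case of T-monotonicity; so p = 0. *)
Lemma T_monotone_le f g y w : leV' i Hp f g ->
  (A y - f) (posV i Hp (y - w)) <= 0 -> 0 <= (A w - g) (posV i Hp (y - w)) ->
  leH Hp (i y) (i w).
Proof.
move=> fg; have [] := TA y w.
set p := posV i Hp (y - w) => p0 /proj1 pE; have := fg p.
rewrite !dualB posVE => /(_ (pos_ge0 supHp _)) fgp h1 h2.
have /(congr1 i) : p = 0.
  by apply: pE; apply/eqP; rewrite eq_le p0 andbT dualB; lra.
rewrite posVE linear0 linearB => pos0.
by have := pos_ge supHp (i y - i w); rewrite pos0 /leH sub0r opprB.
Qed.

(** The test element is y - (y - w)^+ = inf (y, w), admissible because it is below y. *)
Lemma VI_test_below f psi w : Hp psi ->
  (A (S f psi) - f) (posV i Hp (S f psi - w)) <= 0.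
Proof.
move=> Hpsi; have [Ky yP] := VI_solutionP f Hpsi.
set y := S f psi in Ky yP *.
have := yP (y - posV i Hp (y - w)); rewrite addrAC subrr add0r dualNr oppr_ge0.
apply; rewrite /obstacle_set /= linearB posVE.
apply: leH_trans Ky => //; rewrite /leH opprB addrCA subrr addr0.
exact: pos_ge0.
Qed.

(** The test element is w + (y - w)^+ = sup (w, y); it stays below psi because [supH] is the least
    upper bound. *)
Lemma VI_test_above f psi y : Hp psi -> leH Hp (i y) psi ->
  0 <= (A (S f psi) - f) (posV i Hp (y - S f psi)).
Proof.
move=> Hpsi ypsi; have [Kw wP] := VI_solutionP f Hpsi.
set w := S f psi in Kw wP *.
have := wP (w + posV i Hp (y - w)); rewrite addrAC subrr add0r.
apply; rewrite /obstacle_set /= linearD posVE linearB.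
by have [_ _] := supHp (i w) (i y); apply.
Qed.

Lemma VI_solution_le f g psi phi : Hp psi -> leV' i Hp f g -> leH Hp psi phi ->
  leH Hp (i (S f psi)) (i (S g phi)).
Proof.
move=> Hpsi fg pp; have Hphi := leH_ge0 coneHp Hpsi pp.
apply: (T_monotone_le fg); first exact: VI_test_below.
apply: VI_test_above => //; apply: leH_trans pp => //.
by have [] := VI_solutionP f Hpsi.
Qed.

(** Comparison with 0, which solves A(0) = 0 by homogeneity. *)
Lemma VI_solution_ge0 f psi : Hp psi -> leV' i Hp 0 f -> Hp (i (S f psi)).
Proof.
move=> Hpsi f0; apply/leH0; rewrite -[X in leH _ X _](linear0 i).
apply: (T_monotone_le f0); first by rewrite operator0// subrr.
by apply: VI_test_above => //; rewrite linear0; apply/leH0.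
Qed.

Lemma VI_solution_le_state f F psi : Hp psi -> leV' i Hp f F ->
  leH Hp (i (S f psi)) (i (state A F)).
Proof.
move=> Hpsi fF; apply: (T_monotone_le fF); first exact: VI_test_below.
by rewrite stateP// subrr.
Qed.

Lemma VI_solutionZ (t : R) f psi : 0 < t -> Hp psi ->
  S (t *: f) (t *: psi) = t *: S f psi.
Proof.
move=> t0 Hpsi; have [Ky yP] := VI_solutionP f Hpsi.
apply/esym/obstacle_VI_unique.
split=> [|v].
  rewrite /obstacle_set /= linearZ /leH -scalerBr.
  by apply: cone_scale => //; exact: ltW.
move=> Kv; rewrite /obstacle_set /= in Kv.
(* Scaling by t maps K(psi) onto K(t psi), so each test element v comes from t^-1 v. *)
have Kv' : K psi (t^-1 *: v).
  rewrite /obstacle_set /= linearZ /leH.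
  have -> : psi - t^-1 *: i v = t^-1 *: (t *: psi - i v).
    by rewrite scalerBr scalerA mulVf ?gt_eqF// scale1r.
  by apply: cone_scale => //; rewrite invr_ge0 ltW.
have h := yP _ Kv'; have -> : v - t *: S f psi = t *: (t^-1 *: v - S f psi).
  by rewrite scalerBr scalerA divff ?gt_eqF// scale1r.
by rewrite homA// -[_ - t *: f]scalerBr dualZ dualZr !mulr_ge0// ltW.
Qed.

End obstacle.

(** * Minimal solutions of the quasi-variational inequality *)

Section quasi_variational_inequality.
Context (R : realType) (V H : hilbertType R) (i : gelfand_embedding V H).
Variables (Hp : set H) (A : V -> dual V) (Phi : H -> H).
Hypotheses (coneHp : self_dual_cone Hp) (supHp : sup_is_supremum Hp).
Hypotheses (posHp : pos_stable i Hp).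
Hypotheses (homA : homogeneous1 A) (lipA : lipschitz_dual A)
  (monA : strongly_monotone A) (TA : T_monotone i Hp A).
Hypotheses (Phi_ge0 : forall x, Hp x -> Hp (Phi x))
  (Phi_le : forall v w, leH Hp 0 v -> leH Hp v w -> leH Hp (Phi v) (Phi w)).
Implicit Types (f g F : dual V).

Local Notation S := (VI_solution i Hp A).
Local Notation K := (obstacle_set i Hp).
Local Notation m F f := (min_solution i Hp A F Phi f).

Lemma leV'_refl f : leV' i Hp f f.
Proof. by move=> v _; rewrite dualB subrr. Qed.

Lemma extend_ge0 x : Hp (extend Hp Phi x).
Proof. by apply: Phi_ge0; exact: pos_ge0. Qed.

Lemma extend_le x y : leH Hp x y -> leH Hp (extend Hp Phi x) (extend Hp Phi y).
Proof.
by move=> xy; apply: Phi_le; [apply/leH0; exact: pos_ge0|exact: pos_le].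
Qed.

(** The map T sends H into [0, ybar], so ybar is a supersolution and [least_prefixed_point] applies;
    this also rules out the default value in [min_solution]. Leastness among all supersolutions in
    the cone is what the later comparisons use. *)
Lemma min_solutionP F f : leV' i Hp 0 f -> leV' i Hp f F ->
  QVI_solutions i Hp A F Phi f (m F f) /\
  forall z, Hp z -> leH Hp (i (S f (extend Hp Phi z))) z -> leH Hp (i (m F f)) z.
Proof.
move=> f0 fF; pose T z := i (S f (extend Hp Phi z)).
have T0 z : Hp (T z) by apply: VI_solution_ge0 => //; exact: extend_ge0.
have TF z : leH Hp (T z) (i (state A F)).
  by apply: VI_solution_le_state => //; exact: extend_ge0.
have [//|x y _ xy||z [Hz zT zmin]] := @least_prefixed_point _ _ _ coneHp supHp T.
- by apply: VI_solution_le => //; [exact: extend_ge0|exact: leV'_refl|exact: extend_le].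
- by exists (i (state A F)); [apply: leH_ge0 (T0 0) (TF 0)|exact: TF].
(* The fixed point z is found in H; being a value of T, it is the image of some u in V. *)
pose u := S f (extend Hp Phi z); have zu : i u = z by [].
have uP : QVI_solutions i Hp A F Phi f u.
  by split; [apply/leH0; rewrite zu|rewrite zu zT; exact: TF|rewrite zu].
have QVI_prefixed y : QVI_solutions i Hp A F Phi f y -> leH Hp z (i y).
  move=> [y0 _ yS]; apply: zmin; first exact/leH0.
  by rewrite /T -yS; exact: leH_refl.
have [mP mmin] : QVI_solutions i Hp A F Phi f (m F f) /\
    forall y, QVI_solutions i Hp A F Phi f y -> leH Hp (i (m F f)) (i y).
  apply: (@xgetPex _ 0 [set y | QVI_solutions i Hp A F Phi f y /\
    forall z, QVI_solutions i Hp A F Phi f z -> leH Hp (i y) (i z)]).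
  by exists u; split => // y /QVI_prefixed; rewrite zu.
split => // w Hw Tw; apply: leH_trans (mmin _ uP) _ => //.
by rewrite zu; exact: zmin.
Qed.

Lemma leH_cvg (x y : nat -> H) a b : x @ \oo --> a -> y @ \oo --> b ->
  (forall n, leH Hp (x n) (y n)) -> leH Hp a b.
Proof.
move=> xa yb xy; have [cHp _ _ _] := coneHp.
apply: (@closed_cvg _ _ \oo _ (fun n => y n - x n) Hp) => //.
  by apply: nearW => n; exact: xy.
exact: cvgB.
Qed.

(* lambda m(f) is a supersolution for every g <= lambda f. *)
Lemma min_solution_scale F f g (lambda : R) :
  leV' i Hp 0 f -> leV' i Hp f F -> leV' i Hp 0 g -> leV' i Hp g F ->
  (forall y, Hp y -> leH Hp (Phi (lambda *: y)) (lambda *: Phi y)) ->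
  0 < lambda -> leV' i Hp g (lambda *: f) ->
  leH Hp (i (m F g)) (lambda *: i (m F f)).
Proof.
move=> f0 fF g0 gF Phil l0 gf.
have [[/leH0 Hm _ mS] _] := min_solutionP f0 fF.
have [_ gmin] := min_solutionP g0 gF.
have Hlm : Hp (lambda *: i (m F f)) by apply: cone_scale => //; exact: ltW.
(* By homogeneity lambda m(f) = S(lambda f, lambda Phi(m(f))), which dominates S(g, Phi(lambda
   m(f))). *)
apply: gmin => //; rewrite {2}mS -[X in leH _ _ X]linearZ -VI_solutionZ//;
  last exact: extend_ge0.
apply: VI_solution_le => //; first exact: extend_ge0.
by rewrite /extend !pos_id//; exact: Phil.
Qed.

(** The obstacles approach [psis] from above, so every element of K(psis), and in particular the
    weak limit, is an admissible test element for each n. *)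
Lemma VI_solution_cvg (g psi : nat -> H) (gs psis h : H) (y : nat -> V) (B : R) :
  g @ \oo --> gs -> (forall n, Hp (psi n)) -> (forall n, leH Hp psis (psi n)) ->
  psi @ \oo --> psis -> (forall n, y n = S (pivot i (g n)) (psi n)) ->
  (forall n, `|y n| <= B) -> i (y n) @[n --> \oo] --> h ->
  exists p, [/\ i p = h, y @ \oo --> p & p = S (pivot i gs) psis].
Proof.
move=> ggs psi0 psile psicvg yS yB yh.
have [p ip weakp] := weak_limit yB yh.
have yP n : VI A (pivot i (g n)) (K (psi n)) (y n) by rewrite yS; exact: VI_solutionP.
have Kp : K psis p.
  by rewrite /obstacle_set /= ip; apply: leH_cvg yh psicvg _ => n; have [] := yP n.
have [b [C [bP bC]]] := operator_riesz lipA.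
have [c c0 Ac] := monA.
have pivE k v : pivot i k v = inner k (i v) by [].
have test v n : K psis v -> 0 <= inner (b (y n)) (v - y n) - inner (g n) (i v - i (y n)).
  move=> Kv; rewrite -bP -linearB -pivE -dualB; apply: (yP n).2.
  by apply: leH_trans (psile n) => //.
have strong : y @ \oo --> p.
  (* Strong monotonicity combined with the test element p bounds c |y_n - p|^2 by e n, which tends
     to 0 by strong convergence in H and weak convergence in V. *)
  pose e n := inner (g n) (i (y n) - h) - (inner (b p) (y n) - inner (b p) p).
  have e0 : e @ \oo --> 0.
    have -> : 0 = inner gs (h - h) - (inner (b p) p - inner (b p) p).
      by rewrite !subrr inner0r subr0.
    apply: cvgB.
      by apply: cvg_inner => //; apply: cvgB => //; exact: cvg_cst.
    by apply: cvgB; [exact: weakp|exact: cvg_cst].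
  have ye n : c * `|p - y n| ^+ 2 <= e n.
    rewrite distrC; apply: (le_trans (Ac _ _)); have := test p n Kp.
    rewrite dualB !bP /e -ip -[p - _]opprB -[i p - _]opprB !innerNr.
    by rewrite [inner (b p) (y n - p)]innerDr innerNr; lra.
  apply/cvgrPdist_lt => d d0.
  have : \forall n \near \oo, e n < c * d ^+ 2.
    by apply: (cvgr_lt 0) => //; rewrite mulr_gt0// exprn_gt0.
  apply: filterS => n /(le_lt_trans (ye n)).
  by rewrite ltr_pM2l// ltr_pXn2r// ?nnegrE // (ltW d0).
exists p; split => //; apply: obstacle_VI_unique => //; split => // v Kv.
have bcvg : b (y n) @[n --> \oo] --> b p.
  apply/cvgrPdist_lt => d d0.
  have C0 : 0 < `|C| + 1 by rewrite ltr_wpDl.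
  have : \forall n \near \oo, `|p - y n| < d / (`|C| + 1).
    by move/cvgrPdist_lt : strong; apply; rewrite divr_gt0.
  apply: filterS => n; rewrite ltr_pdivlMr//; apply: le_lt_trans.
  apply: (le_trans (bC _ _)); rewrite mulrC ler_wpM2l//.
  by have := ler_norm C; lra.
have vcvg : inner (b (y n)) (v - y n) - inner (g n) (i v - i (y n)) @[n --> \oo] -->
    inner (b p) (v - p) - inner gs (i v - h).
  apply: cvgB; apply: cvg_inner => //; apply: cvgB => //; exact: cvg_cst.
rewrite dualB bP pivE linearB ip -(cvg_lim _ vcvg)//.
apply: limr_ge; first by apply/cvg_ex; eexists; exact: vcvg.
by apply: nearW => n; exact: test.
Qed.

(** The functions on Omega are abstracted away: all that remains of the bound by nu is the sequence
    [lambda]. *)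
Lemma min_solution_cvg F (g : nat -> H) (gs : H) (lambda : nat -> R) :
  (forall n, leV' i Hp 0 (pivot i (g n))) -> (forall n, leV' i Hp (pivot i (g n)) F) ->
  leV' i Hp 0 (pivot i gs) -> leV' i Hp (pivot i gs) F ->
  (forall n, leV' i Hp (pivot i (g n.+1)) (pivot i (g n))) ->
  g @ \oo --> gs ->
  (forall n, 1 < lambda n) -> lambda @ \oo --> (1 : R) ->
  (forall n, leV' i Hp (pivot i (g n)) (lambda n *: pivot i gs)) ->
  (forall (l : R) y, 1 < l -> Hp y -> leH Hp (Phi (l *: y)) (l *: Phi y)) ->
  (forall (v : nat -> V) (w : H),
     (exists B : R, forall k, `|v k| <= B) -> decreases_to Hp (i \o v) w ->
     extend Hp Phi (i (v k)) @[k --> \oo] --> extend Hp Phi w) ->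
  decreases_to Hp (fun n => i (m F (pivot i (g n)))) (i (m F (pivot i gs))) /\
  m F (pivot i (g n)) @[n --> \oo] --> m F (pivot i gs).
Proof.
move=> g0 gF gs0 gsF gdec ggs lambda1 lambdacvg glambda Phil Phicvg.
pose y n := m F (pivot i (g n)).
have yP n : QVI_solutions i Hp A F Phi (pivot i (g n)) (y n) by exact: (min_solutionP _ _).1.
have Hy n : Hp (i (y n)) by have [/leH0] := yP n.
(* y n is a supersolution for the smaller datum g n.+1. *)
have ydec n : leH Hp (i (y n.+1)) (i (y n)).
  apply: (min_solutionP (g0 _) (gF _)).2 => //.
  have [_ _ {2}->] := yP n; apply: VI_solution_le => //; [exact: extend_ge0|exact: leH_refl].
have [l [yl Hl ly]] := decreasing_cvg coneHp supHp Hy ydec.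
have [c c0 Ac] := monA; have [F0 F0P] := dual_riesz F.
(* Testing with 0 gives c |y_n|^2 <= A(y_n) y_n <= (g_n, y_n) <= F(y_n), the last step because y_n
   >= 0. *)
have yB n : `|y n| <= `|F0| / c.
  have [_ _ yS] := yP n; have Hpsi := extend_ge0 (i (y n)).
  have [_] := VI_solutionP i coneHp lipA monA (pivot i (g n)) Hpsi.
  rewrite -yS => /(_ 0); rewrite sub0r dualNr dualB => test.
  have {test}/test test : obstacle_set i Hp (extend Hp Phi (i (y n))) 0.
    by rewrite /obstacle_set /= linear0; exact/leH0.
  have := Ac (y n) 0; rewrite operator0// !subr0 => Acy.
  have := gF n _ (Hy n); rewrite dualB => gFy.
  have Fy : F (y n) <= `|F0| * `|y n|.
    by rewrite F0P (le_trans (ler_norm _))// norm_inner_le.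
  have [->|yn0] := eqVneq (y n) 0; first by rewrite normr0 divr_ge0// ltW.
  rewrite ler_pdivlMr// -(@ler_pM2r _ `|y n|) ?normr_gt0// mulrAC -expr2 mulrC.
  apply: (le_trans Acy); apply: le_trans Fy.
  lra.
have psicvg := Phicvg y l (ex_intro _ _ yB) (conj ydec yl).
have [p [ip yp pS]] := VI_solution_cvg ggs (fun n => extend_ge0 (i (y n)))
  (fun n => extend_le (ly n)) psicvg (fun n => let: And3 _ _ yS := yP n in yS) yB yl.
have pP : QVI_solutions i Hp A F Phi (pivot i gs) p.
  split; rewrite ip//; first exact/leH0.
  by have [_ yF _] := yP 0%N; apply: leH_trans (ly 0%N) yF.
(* One inequality is the limit of y n <= lambda n m(gs); the other holds because p is a fixed point
   for gs. *)
have pm : p = m F (pivot i gs).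
  apply: (@emb_inj _ _ _ i); apply: (leH_anti coneHp).
    pose z n := lambda n *: i (m F (pivot i gs)).
    rewrite ip; apply: (@leH_cvg (i \o y) z) => [//||n].
      rewrite -[X in _ --> X]scale1r; apply: cvgZ; [exact: lambdacvg|exact: cvg_cst].
    apply: min_solution_scale => //; first by move=> x Hx; exact: Phil.
    exact: lt_trans (lambda1 n).
  apply: (min_solutionP gs0 gsF).2; first by rewrite ip.
  by rewrite ip -pS ip; exact: leH_refl.
by rewrite -pm; split => //; split => //; rewrite ip.
Qed.

End quasi_variational_inequality.

(** * Pointwise comparison of essentially bounded functions *)

Section essentially_bounded.
Context (R : realType) (n : nat) (Omega : set 'rV[R]_n.+1).
Implicit Types z f g : Linfty Omega.

Lemma Linfty_norm_fin z : Linfty_norm z = (fine (Linfty_norm z))%:E.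
Proof.
have : finite_norm (lebesgue Omega) +oo z by exact: Lfunction_finite.
by move=> zfin; rewrite fineK// ge0_fin_numE ?Lnorm_ge0//.
Qed.

Lemma le_Linfty_norm z :
  {ae lebesgue Omega, forall x, `|z x| <= fine (Linfty_norm z)}.
Proof.
have := Linfty_norm_fin z; rewrite {1}/Linfty_norm unlock /=.
case: ifPn => [_ ez|].
  have := ess_sup_ge (lebesgue Omega) (abse \o (EFin \o z)).
  by rewrite ez; apply: filterS => x; rewrite /= lee_fin.
(* The norm is the essential supremum only on a domain of positive measure; otherwise the whole
   domain is negligible and any bound holds a.e. *)
rewrite -leNgt => Omega0 _; exists setT; split => //.
by apply/eqP; rewrite eq_le Omega0; exact: lebesgue_outer_ge0.
Qed.

(** As g >= nu, f <= g + a <= g + (a / nu) g <= lambda g. *)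
Lemma Linfty_scale_ge f g (nu a lambda : R) : 0 < nu -> Linfty_ge nu g ->
  {ae lebesgue Omega, forall x, `|(f - g) x| <= a} -> 1 + a / nu <= lambda ->
  {ae lebesgue Omega, forall x, 0 <= (lambda *: g - f) x}.
Proof.
move=> nu0 gnu fga al; apply: filterS2 gnu fga => x gx.
have -> : (f - g) x = f x - g x by [].
have -> : (lambda *: g - f) x = lambda * g x - f x by [].
move=> /ler_normlP[h1 h2].
have : (1 + a / nu) * g x <= lambda * g x by rewrite ler_wpM2r//; lra.
have a0 : 0 <= a by lra.
have : a / nu * nu <= a / nu * g x by rewrite ler_wpM2l// divr_ge0// ltW.
rewrite divfK ?gt_eqF//; lra.
Qed.

End essentially_bounded.

Theorem lemma2 (R : realType) (n : nat) (Omega : set 'rV[R]_n.+1)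
    (V H : hilbertType R) (i : gelfand_embedding V H) (Hp : set H)
    (repr : H -> {mfun domain Omega >-> R}) (incl : {linear Linfty Omega -> H})
    (A : V -> dual V) (Phi : H -> H) (nu : R) (F : dual V)
    (f : nat -> Linfty Omega) (fstar : Linfty Omega) :
  open Omega ->
  self_dual_cone Hp ->
  sup_is_supremum Hp ->
  pos_stable i Hp ->
  function_space Hp repr incl ->
  homogeneous1 A -> lipschitz_dual A -> strongly_monotone A -> T_monotone i Hp A ->
  (forall x, Hp x -> Hp (Phi x)) ->
  (forall v w, leH Hp 0 v -> leH Hp v w -> leH Hp (Phi v) (Phi w)) ->
  0 < nu ->
  leV' i Hp 0 F ->
  (forall k, Linfty_ge nu (f k)) ->
  (forall k, leV' i Hp 0 (pivot i (incl (f k))) /\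
             leV' i Hp (pivot i (incl (f k))) F) ->
  (forall k, leH Hp (incl (f k.+1)) (incl (f k))) ->
  Linfty_ge nu fstar ->
  Linfty_norm (f k - fstar) @[k --> \oo] --> 0%E ->
  (forall (lambda : R) y, 1 < lambda -> Hp y ->
     leH Hp (Phi (lambda *: y)) (lambda *: Phi y)) ->
  (forall (v : nat -> V) (w : H),
     (exists B : R, forall k, `|v k| <= B) ->
     decreases_to Hp (i \o v) w ->
     extend Hp Phi (i (v k)) @[k --> \oo] --> extend Hp Phi w) ->
  let m z := min_solution i Hp A F Phi (pivot i (incl z)) in
  decreases_to Hp (fun k => i (m (f k))) (i (m fstar)) /\
  m (f k) @[k --> \oo] --> m fstar.
Proof.
move=> _ coneHp supHp posHp fsp homA lipA monA TA Phi0 Phile nu0 _ _ f0F fdec.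
move=> fsnu fcvg Phil Phicvg m.
pose a k := fine (Linfty_norm (f k - fstar)).
have acvg : a @ \oo --> (0 : R) by exact: fine_cvg.
have icvg : incl (f k) @[k --> \oo] --> incl fstar.
  have [C CP] := incl_continuous fsp.
  apply/cvgrPdist_lt => e e0.
  have C0 : 0 < `|C| + 1 by rewrite ltr_wpDl.
  have : \forall k \near \oo, a k < e / (`|C| + 1).
    by apply: (cvgr_lt 0) => //; rewrite divr_gt0.
  apply: filterS => k; rewrite ltr_pdivlMr// distrC -linearB; apply: le_lt_trans.
  have := CP (f k - fstar); rewrite Linfty_norm_fin -EFinM lee_fin -/(a k).
  move=> h; apply: (le_trans h); rewrite mulrC ler_wpM2l//.
    by apply: fine_ge0; exact: Lnorm_ge0.
  by have := ler_norm C; lra.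
have pivotE h v : pivot i h v = inner h (i v) by [].
have pcvg v : pivot i (incl (f k)) v @[k --> \oo] --> pivot i (incl fstar) v.
  by rewrite pivotE; apply: cvg_inner => //; exact: cvg_cst.
have f0 k := (f0F k).1; have fF k := (f0F k).2.
(* The factor 1 + a k / nu comes from [Linfty_scale_ge]; the harmonic term keeps lambda k strictly
   above 1 even when a k = 0, as the condition on [Phi] requires. *)
pose lambda k := 1 + a k / nu + harmonic k.
have a0 k : 0 <= a k by apply: fine_ge0; exact: Lnorm_ge0.
apply: (@min_solution_cvg _ _ _ _ _ _ _ coneHp supHp posHp homA lipA monA TA
  Phi0 Phile F (fun k => incl (f k)) (incl fstar) lambda) => //.
(* Both order bounds on [fstar] in V' are limits of those on f k, tested against each v >= 0. *)
- move=> v Hv; rewrite dualB subr0.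
  rewrite -(cvg_lim _ (pcvg v))//; apply: limr_ge.
    by apply/cvg_ex; eexists; exact: pcvg.
  by apply: nearW => k; have := f0 k v Hv; rewrite dualB subr0.
- move=> v Hv; rewrite dualB subr_ge0.
  rewrite -(cvg_lim _ (pcvg v))//; apply: limr_le.
    by apply/cvg_ex; eexists; exact: pcvg.
  by apply: nearW => k; have := fF k v Hv; rewrite dualB subr_ge0.
- move=> k v Hv; rewrite dualB !pivotE -innerNl -innerDl.
  by apply: (cone_inner coneHp) => //; exact: fdec.
- by move=> k; rewrite /lambda -addrA ltrDl ltr_wpDl ?harmonic_gt0// divr_ge0// ltW.
- rewrite -[X in _ --> X]addr0; apply: cvgD; last exact: cvg_harmonic.
  rewrite -[X in _ --> X]addr0; apply: cvgD; first exact: cvg_cst.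
  by rewrite -(mul0r nu^-1); apply: cvgMr_tmp.
(* The a.e. inequality f k <= lambda k fstar passes to the order of H by [incl_order], then to that
   of V' since the cone is self-dual. *)
- move=> k v Hv; rewrite dualB dualZ !pivotE -innerZl -innerNl -innerDl.
  apply: (cone_inner coneHp) => //; rewrite -linearZ -linearB.
  apply/(incl_order fsp); apply: Linfty_scale_ge nu0 fsnu (le_Linfty_norm _) _.
  by rewrite /lambda lerDl; exact: harmonic_ge0.
Qed.
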